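(* Let $R$ be a ring and let $\mathtt{A}$ be the abelian category of $R$-modules. Equip $\mathtt{A}$ with the fiber-cofiber structure in which the fiber of a morphism $a:X\to Y$ is its kernel $\mathrm{Ker}(a)$ and the cofiber is its cokernel $\mathrm{Coker}(a)$, with the induced maps between fibers and between cofibers given by the universal properties of kernels and cokernels. Then $\mathtt{A}$ is a bicharadic category (see the context).
   Context: **Fiber-cofiber structure.** Every morphism $h:S\to T$ has a fiber (here a chosen kernel) and a cofiber (here a chosen cokernel). For $S\xrightarrow{h}T\xrightarrow{g}Z$ there is an induced map between fibers $h_Z:X\to Y$, where $X$ is the fiber of $gh$ and $Y$ the fiber of $g$ (here the unique map $\mathrm{Ker}(gh)\to\mathrm{Ker}(g)$ compatible with $h$). There is also an induced map between cofibers $g^S:D\to K$, where $D$ is the cofiber of $h$ and $K$ the cofiber of $gh$ (here the unique map $\mathrm{Coker}(h)\to\mathrm{Coker}(gh)$ compatible with $g$). Both are functorial. In a unary operadic category one requires that the fiber of $h_Z$ equals the fiber of $h$, and dually that the cofiber of $g^S$ equals the cofiber of $g$. For kernels and cokernels these requirements are understood up to the canonical isomorphisms $\mathrm{Ker}(h_Z)\cong\mathrm{Ker}(h)$ (compatible with the maps to $S$) and $\mathrm{Coker}(g)\cong\mathrm{Coker}(g^S)$ (compatible with the maps from $Z$). **Bicharadic.** A category with such a structure is bicharadic if the following two conditions hold. (1) For all $S\xrightarrow{h}T\xrightarrow{g}Z$ there is an isomorphism $\rho:\mho\to\Omega$ from the cofiber $\mho$ of $h_Z$ to the fiber $\Omega$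 of $g^S$. It is natural in the following sense. Let $h':S\to T'$, $g':T'\to Z$, $h'':S\to T''$, $g'':T''\to Z$ and $u:T'\to T''$ satisfy $uh'=h''$ and $g''u=g'$ (so $g'h'=g''h''$). Let $X$ and $K$ be the fiber and cofiber of $g'h'=g''h''$, let $\mho',\mho''$ be the cofibers of $h'_Z,h''_Z$, and let $\Omega',\Omega''$ be the fibers of $g'^S,g''^S$. Then $u$ induces $u_Z$ between the fibers of $g'$ and $g''$, with $u_Zh'_Z=h''_Z$, and hence $u_Z^X:\mho'\to\mho''$ between cofibers. Dually, $u$ induces a map $u^S$ between the cofibers of $h'$ and $h''$, with $g''^S u^S=g'^S$, and hence $u^S_K:\Omega'\to\Omega''$ between fibers. Naturality means $\rho''\circ u_Z^X=u^S_K\circ\rho'$. (2) For every commutative square $t h'=h'' s$ with $h':S'\to T'$, $h'':S''\to T''$ and isomorphisms $s:S'\to S''$, $t:T'\to T''$, there are induced isomorphisms $s_t:F'\to F''$ between the fibers and $t_s:D'\to D''$ between the cofibers of $h'$ and $h''$. These are functorial with respect to composition of such squares, and satisfy the following. If $T'=T''=T$ and $t=\mathrm{id}$, so that $h'=h''s$, then $s_t$ is the induced map between fibers $s_T:F'\to F''$ associated with $S'\xrightarrow{s}S''\xrightarrow{h''}T$ (here the unique map $\mathrm{Ker}(h')\to\mathrm{Ker}(h'')$ compatible with $s$). If $S'=S''=S$ and $s=\mathrm{id}$, so that $th'=h''$, then $t_s$ is the induced map between cofibers $t^S:D'\to D''$ associated with $S\xrightarrow{h'}T'\xrightarrow{t}T''$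 (here the unique map $\mathrm{Coker}(h')\to\mathrm{Coker}(h'')$ compatible with $t$). *)

(* Defs.v *)
From HB Require Import structures.
From mathcomp Require Import all_boot all_algebra boolp.

Set Implicit Arguments.
Unset Strict Implicit.
Unset Printing Implicit Defensive.

Import GRing.Theory.
Local Open Scope ring_scope.

Declare Scope cat_scope.
Delimit Scope cat_scope with cat.

Record category := Category {
  obj :> Type;
  hom : obj -> obj -> Type;
  idm : forall a, hom a a;
  ccomp : forall a b c, hom b c -> hom a b -> hom a c;
  ccomp1m : forall a b (f : hom a b), ccomp (idm b) f = f;
  ccompm1 : forall a b (f : hom a b), ccomp f (idm a) = f;
  ccompA : forall a b c d (h : hom c d) (g : hom b c) (f : hom a b),
    ccomp h (ccomp g f) = ccomp (ccomp h g) f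
}.

Arguments hom {_}.
Arguments idm {_}.
Arguments ccomp {_ _ _ _}.
Arguments ccomp1m {_ _ _}.
Arguments ccompm1 {_ _ _}.
Arguments ccompA {_ _ _ _ _}.

Notation "g ∘ f" := (ccomp g f) (at level 40, left associativity) : cat_scope.
Local Open Scope cat_scope.

Definition is_iso (C : category) (a b : C) (f : hom a b) : Prop :=
  exists g : hom b a, g ∘ f = idm a /\ f ∘ g = idm b.

(** [fibM] is the induced map between fibers and [cofM] the induced map between
    cofibers.  They are indexed by a composite [f] together with a proof of
    [g ∘ h = f], rather than having [g ∘ h] substituted for [f]: when
    [g' ∘ h' = g'' ∘ h''], the two objects [fib (g' ∘ h')] and
    [fib (g'' ∘ h'')] are not convertible, whereas here both are [fib f].
    In other words [fibM] is the action on arrows of a functor on the slice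
    over [Z], and [cofM] that of a functor on the coslice under [S].
    The maps [fib_in] and [cof_pr] serve to say what it means for the
    isomorphisms in [fib_of_fibM] and [cof_of_cofM] to be canonical. *)
Record fcData (C : category) := FCData {
  fib : forall S T : C, hom S T -> C;
  fib_in : forall (S T : C) (h : hom S T), hom (fib h) S;
  cof : forall S T : C, hom S T -> C;
  cof_pr : forall (S T : C) (h : hom S T), hom T (cof h);
  fibM : forall (S T Z : C) (h : hom S T) (g : hom T Z) (f : hom S Z),
    g ∘ h = f -> hom (fib f) (fib g);
  cofM : forall (S T Z : C) (h : hom S T) (g : hom T Z) (f : hom S Z),
    g ∘ h = f -> hom (cof h) (cof f)
}.

Arguments fib {C} _ {S T} h.
Arguments fib_in {C} _ {S T} h.
Arguments cof {C} _ {S T} h.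
Arguments cof_pr {C} _ {S T} h.
Arguments fibM {C} _ {S T Z h g f}.
Arguments cofM {C} _ {S T Z h g f}.

Record fcAxioms (C : category) (D : fcData C) : Prop := FCAxioms {
  fibM_id : forall (S Z : C) (f : hom S Z) (E : f ∘ idm S = f),
    fibM D E = idm (fib D f);
  fibM_comp : forall (S T U Z : C)
      (f : hom S Z) (g : hom T Z) (k : hom U Z)
      (h : hom S T) (u : hom T U) (v : hom S U)
      (E1 : g ∘ h = f) (E2 : k ∘ u = g) (E3 : k ∘ v = f),
    u ∘ h = v -> fibM D E2 ∘ fibM D E1 = fibM D E3;
  cofM_id : forall (S T : C) (h : hom S T) (E : idm T ∘ h = h),
    cofM D E = idm (cof D h);
  cofM_comp : forall (S T U Z : C)
      (h : hom S T) (k : hom S U) (f : hom S Z)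
      (u : hom T U) (g : hom U Z) (v : hom T Z)
      (E1 : u ∘ h = k) (E2 : g ∘ k = f) (E3 : v ∘ h = f),
    g ∘ u = v -> cofM D E2 ∘ cofM D E1 = cofM D E3;
  fib_of_fibM : forall (S T Z : C) (h : hom S T) (g : hom T Z) (f : hom S Z)
      (E : g ∘ h = f),
    exists th : hom (fib D (fibM D E)) (fib D h),
      is_iso th /\ fib_in D h ∘ th = fib_in D f ∘ fib_in D (fibM D E);
  cof_of_cofM : forall (S T Z : C) (h : hom S T) (g : hom T Z) (f : hom S Z)
      (E : g ∘ h = f),
    exists th : hom (cof D g) (cof D (cofM D E)),
      is_iso th /\ th ∘ cof_pr D g = cof_pr D (cofM D E) ∘ cof_pr D f
}.

Definition rho_family (C : category) (D : fcData C) :=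
  forall (S T Z : C) (h : hom S T) (g : hom T Z) (f : hom S Z)
    (E : g ∘ h = f),
  hom (cof D (fibM D E)) (fib D (cofM D E)).

(** The two appeals to functoriality are the equalities [u_Z ∘ h'_Z = h''_Z] and
    [g''^S ∘ u^S = g'^S]. *)
Definition rho_natural (C : category) (D : fcData C) (A : fcAxioms D)
    (rho : rho_family D) : Prop :=
  forall (S T' T'' Z : C) (f : hom S Z)
    (h' : hom S T') (g' : hom T' Z) (h'' : hom S T'') (g'' : hom T'' Z)
    (u : hom T' T'')
    (E' : g' ∘ h' = f) (E'' : g'' ∘ h'' = f)
    (Eh : u ∘ h' = h'') (Eg : g'' ∘ u = g'),
  rho _ _ _ _ _ _ E'' ∘ cofM D (fibM_comp A E' Eg E'' Eh)
  = fibM D (cofM_comp A Eh E'' E' Eg) ∘ rho _ _ _ _ _ _ E'.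

Definition bicharadic1 (C : category) (D : fcData C) (A : fcAxioms D) : Prop :=
  exists rho : rho_family D,
    (forall (S T Z : C) (h : hom S T) (g : hom T Z) (f : hom S Z)
       (E : g ∘ h = f), is_iso (rho _ _ _ _ _ _ E))
    /\ rho_natural A rho.

Record isoSquare (C : category) (S' T' S'' T'' : C)
    (h' : hom S' T') (h'' : hom S'' T'') (s : hom S' S'') (t : hom T' T'') :
    Prop := IsoSquare {
  isq_s : is_iso s;
  isq_t : is_iso t;
  isq_comm : t ∘ h' = h'' ∘ s
}.

(** [sfib q] is [s_t] and [tcof q] is [t_s]. *)
Definition bicharadic2 (C : category) (D : fcData C) : Prop :=
  exists (sfib : forall (S' T' S'' T'' : C) (h' : hom S' T')
                   (h'' : hom S'' T'') (s : hom S' S'') (t : hom T' T''),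
             isoSquare h' h'' s t -> hom (fib D h') (fib D h''))
         (tcof : forall (S' T' S'' T'' : C) (h' : hom S' T')
                   (h'' : hom S'' T'') (s : hom S' S'') (t : hom T' T''),
             isoSquare h' h'' s t -> hom (cof D h') (cof D h'')),
  [/\ forall (S' T' S'' T'' : C) (h' : hom S' T') (h'' : hom S'' T'')
        (s : hom S' S'') (t : hom T' T'') (q : isoSquare h' h'' s t),
        is_iso (sfib _ _ _ _ _ _ _ _ q) /\ is_iso (tcof _ _ _ _ _ _ _ _ q),
      forall (S T : C) (h : hom S T) (q : isoSquare h h (idm S) (idm T)),
        sfib _ _ _ _ _ _ _ _ q = idm (fib D h)
        /\ tcof _ _ _ _ _ _ _ _ q = idm (cof D h),
      forall (S1 T1 S2 T2 S3 T3 : C)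
        (h1 : hom S1 T1) (h2 : hom S2 T2) (h3 : hom S3 T3)
        (s : hom S1 S2) (t : hom T1 T2) (s' : hom S2 S3) (t' : hom T2 T3)
        (q : isoSquare h1 h2 s t) (q' : isoSquare h2 h3 s' t')
        (r : isoSquare h1 h3 (s' ∘ s) (t' ∘ t)),
        sfib _ _ _ _ _ _ _ _ q' ∘ sfib _ _ _ _ _ _ _ _ q
          = sfib _ _ _ _ _ _ _ _ r
        /\ tcof _ _ _ _ _ _ _ _ q' ∘ tcof _ _ _ _ _ _ _ _ q
          = tcof _ _ _ _ _ _ _ _ r,
      forall (S' S'' T : C) (h' : hom S' T) (h'' : hom S'' T) (s : hom S' S'')
        (q : isoSquare h' h'' s (idm T)) (E : h'' ∘ s = h'),
        sfib _ _ _ _ _ _ _ _ q = fibM D E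
    & forall (S T' T'' : C) (h' : hom S T') (h'' : hom S T'') (t : hom T' T'')
        (q : isoSquare h' h'' (idm S) t) (E : t ∘ h' = h''),
        tcof _ _ _ _ _ _ _ _ q = cofM D E].

Record bicharadic (C : category) (D : fcData C) : Prop := Bicharadic {
  bichar_fc : fcAxioms D;
  bichar_rho : bicharadic1 bichar_fc;
  bichar_iso : bicharadic2 D
}.

Lemma linear_ext (R : pzRingType) (U V : lmodType R) (f g : {linear U -> V}) :
  (f : U -> V) =1 g -> f = g.
Proof.
case: f => f [[fD] [fZ]]; case: g => g [[gD] [gZ]] /= /funext E.
rewrite /= in E; subst g.
by rewrite (Prop_irrelevance fD gD) (Prop_irrelevance fZ gZ).
Qed.

Definition lin_comp (R : pzRingType) (U V W : lmodType R)
  (g : {linear V -> W}) (f : {linear U -> V}) : {linear U -> W} := g \o f.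

Definition lin_id (R : pzRingType) (U : lmodType R) : {linear U -> U} := idfun.

Lemma lin_comp1m (R : pzRingType) (U V : lmodType R) (f : {linear U -> V}) :
  lin_comp (lin_id V) f = f.
Proof. exact: linear_ext. Qed.

Lemma lin_compm1 (R : pzRingType) (U V : lmodType R) (f : {linear U -> V}) :
  lin_comp f (lin_id U) = f.
Proof. exact: linear_ext. Qed.

Lemma lin_compA (R : pzRingType) (U V W X : lmodType R)
    (h : {linear W -> X}) (g : {linear V -> W}) (f : {linear U -> V}) :
  lin_comp h (lin_comp g f) = lin_comp (lin_comp h g) f.
Proof. exact: linear_ext. Qed.

(** Left modules over a unital associative ring, possibly the zero ring. *)
Definition Mod (R : pzRingType) : category :=
  Category (@lin_comp1m R) (@lin_compm1 R) (@lin_compA R).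

Record kernel (R : pzRingType) (S T : Mod R) (h : hom S T) := Kernel {
  ker : Mod R;
  ker_in : hom ker S;
  ker_in0 : forall x, h (ker_in x) = 0;
  ker_lift : forall (W : Mod R) (w : hom W S),
    (forall x, h (w x) = 0) -> hom W ker;
  ker_liftK : forall (W : Mod R) (w : hom W S) (w0 : forall x, h (w x) = 0),
    ker_in ∘ ker_lift w0 = w;
  ker_uniq : forall (W : Mod R) (v v' : hom W ker),
    ker_in ∘ v = ker_in ∘ v' -> v = v'
}.

Record cokernel (R : pzRingType) (S T : Mod R) (h : hom S T) := Cokernel {
  coker : Mod R;
  coker_pr : hom T coker;
  coker_pr0 : forall x, coker_pr (h x) = 0;
  coker_desc : forall (W : Mod R) (w : hom T W),
    (forall x, w (h x) = 0) -> hom coker W;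
  coker_descK : forall (W : Mod R) (w : hom T W) (w0 : forall x, w (h x) = 0),
    coker_desc w0 ∘ coker_pr = w;
  coker_uniq : forall (W : Mod R) (v v' : hom coker W),
    v ∘ coker_pr = v' ∘ coker_pr -> v = v'
}.

Arguments ker_in {R S T h} _.
Arguments ker_in0 {R S T h} _.
Arguments ker_lift {R S T h} _ {W w}.
Arguments ker_liftK {R S T h} _ {W w}.
Arguments ker_uniq {R S T h} _ {W}.
Arguments coker_pr {R S T h} _.
Arguments coker_pr0 {R S T h} _.
Arguments coker_desc {R S T h} _ {W w}.
Arguments coker_descK {R S T h} _ {W w}.
Arguments coker_uniq {R S T h} _ {W}.

(** A choice of one kernel (resp. cokernel) for each morphism. *)
Definition kernels (R : pzRingType) :=
  forall (S T : Mod R) (h : hom S T), kernel h.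

Definition cokernels (R : pzRingType) :=
  forall (S T : Mod R) (h : hom S T), cokernel h.

Lemma kerM_subproof (R : pzRingType) (k : kernels R) (S T Z : Mod R)
    (h : hom S T) (g : hom T Z) (f : hom S Z) (E : g ∘ h = f)
    (x : ker (k _ _ f)) :
  g ((h ∘ ker_in (k _ _ f)) x) = 0.
Proof.
exact: etrans (congr1 (fun a : {linear S -> Z} => a _) E) (ker_in0 _ x).
Qed.

Lemma cokerM_subproof (R : pzRingType) (c : cokernels R) (S T Z : Mod R)
    (h : hom S T) (g : hom T Z) (f : hom S Z) (E : g ∘ h = f) (x : S) :
  (coker_pr (c _ _ f) ∘ g) (h x) = 0.
Proof.
exact: etrans (congr1 (fun a : {linear S -> Z} => coker_pr _ (a x)) E)
  (coker_pr0 _ x).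
Qed.

Arguments kerM_subproof {R} k {S T Z h g f} E x.
Arguments cokerM_subproof {R} c {S T Z h g f} E x.

Definition ker_coker (R : pzRingType) (k : kernels R) (c : cokernels R) :
    fcData (Mod R) :=
  @FCData (Mod R)
    (fun S T h => ker (k S T h)) (fun S T h => ker_in (k S T h))
    (fun S T h => coker (c S T h)) (fun S T h => coker_pr (c S T h))
    (fun S T Z h g f E => ker_lift (k T Z g) (kerM_subproof k E))
    (fun S T Z h g f E => coker_desc (c S T h) (cokerM_subproof c E)).

(** [std_kernels] and [std_cokernels] below, built from the submodule
    [{x | h x = 0}] and the quotient by the image of [h], show that [kernels R]
    and [cokernels R] are inhabited. *)

Definition in_ker (R : pzRingType) (S T : lmodType R) (h : {linear S -> T}) :
  pred S := fun x => h x == 0.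

Lemma in_ker_submod (R : pzRingType) (S T : lmodType R) (h : {linear S -> T}) :
  GRing.submod_closed (in_ker h).
Proof.
split=> [|a x y]; rewrite !unfold_in ?raddf0 // => /eqP hx /eqP hy.
by rewrite linearP hx hy scaler0 addr0.
Qed.

HB.instance Definition _ (R : pzRingType) (S T : lmodType R)
    (h : {linear S -> T}) :=
  GRing.isSubmodClosed.Build R S (in_ker h) (in_ker_submod h).

Record sub_ker (R : pzRingType) (S T : lmodType R) (h : {linear S -> T}) :=
  SubKer { sub_ker_val : S; sub_kerP : in_ker h sub_ker_val }.

HB.instance Definition _ (R : pzRingType) (S T : lmodType R)
    (h : {linear S -> T}) := [isSub for @sub_ker_val R S T h].
HB.instance Definition _ (R : pzRingType) (S T : lmodType R)
    (h : {linear S -> T}) := [Choice of sub_ker h by <:].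
HB.instance Definition _ (R : pzRingType) (S T : lmodType R)
    (h : {linear S -> T}) := [SubChoice_isSubLmodule of sub_ker h by <:].

Definition sub_ker_in (R : pzRingType) (S T : lmodType R)
  (h : {linear S -> T}) : {linear sub_ker h -> S} := val.

Lemma sub_ker_in0 (R : pzRingType) (S T : lmodType R) (h : {linear S -> T})
  (x : sub_ker h) : h (sub_ker_in h x) = 0.
Proof. exact/eqP/(sub_kerP x). Qed.

Definition sub_ker_lift_fun (R : pzRingType) (S T : lmodType R)
    (h : {linear S -> T}) (W : lmodType R) (w : {linear W -> S})
    (w0 : forall x, h (w x) = 0) (x : W) : sub_ker h :=
  SubKer (introT eqP (w0 x)).

Lemma sub_ker_lift_linear (R : pzRingType) (S T : lmodType R)
    (h : {linear S -> T}) (W : lmodType R) (w : {linear W -> S})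
    (w0 : forall x, h (w x) = 0) : linear (sub_ker_lift_fun w0).
Proof. by move=> a x y; apply/val_inj; rewrite /= linearP. Qed.

HB.instance Definition _ (R : pzRingType) (S T : lmodType R)
    (h : {linear S -> T}) (W : lmodType R) (w : {linear W -> S})
    (w0 : forall x, h (w x) = 0) :=
  GRing.isLinear.Build R W (sub_ker h) *:%R (sub_ker_lift_fun w0)
    (sub_ker_lift_linear w0).

Lemma sub_ker_uniq (R : pzRingType) (S T : lmodType R) (h : {linear S -> T})
    (W : lmodType R) (v v' : {linear W -> sub_ker h}) :
  lin_comp (sub_ker_in h) v = lin_comp (sub_ker_in h) v' -> v = v'.
Proof.
move=> E; apply: linear_ext => x; apply: val_inj.
exact: (congr1 (fun f : {linear W -> S} => f x) E).
Qed.

Lemma sub_ker_liftK (R : pzRingType) (S T : lmodType R) (h : {linear S -> T})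
    (W : lmodType R) (w : {linear W -> S}) (w0 : forall x, h (w x) = 0) :
  lin_comp (sub_ker_in h) (sub_ker_lift_fun w0) = w.
Proof. exact: linear_ext. Qed.

Definition std_kernels (R : pzRingType) : kernels R := fun S T h =>
  @Kernel R S T h (sub_ker h) (sub_ker_in h) (@sub_ker_in0 R S T h)
    (fun W w w0 => sub_ker_lift_fun w0)
    (@sub_ker_liftK R S T h) (@sub_ker_uniq R S T h).

Definition in_im (R : pzRingType) (S T : lmodType R) (h : {linear S -> T}) :
  pred T := fun y => `[< exists x, h x = y >].

Lemma in_im_submod (R : pzRingType) (S T : lmodType R) (h : {linear S -> T}) :
  GRing.submod_closed (in_im h).
Proof.
split=> [|a x y]; rewrite !unfold_in.
  by apply/asboolP; exists 0; rewrite raddf0.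
move=> /asboolP[u <-] /asboolP[v <-]; apply/asboolP.
by exists (a *: u + v); rewrite linearP.
Qed.

HB.instance Definition _ (R : pzRingType) (S T : lmodType R)
    (h : {linear S -> T}) :=
  GRing.isSubmodClosed.Build R T (in_im h) (in_im_submod h).

Definition in_im_zmod (R : pzRingType) (S T : lmodType R)
  (h : {linear S -> T}) : zmodClosed T := GRing.ZmodClosed.clone _ (in_im h) _.

Definition quo_im (R : pzRingType) (S T : lmodType R) (h : {linear S -> T}) :
  Type := Quotient.quot (in_im_zmod h).

HB.instance Definition _ (R : pzRingType) (S T : lmodType R)
    (h : {linear S -> T}) := GRing.Zmodule.on (quo_im h).
HB.instance Definition _ (R : pzRingType) (S T : lmodType R)
    (h : {linear S -> T}) := Quotient.on (quo_im h).

Definition quo_pi (R : pzRingType) (S T : lmodType R) (h : {linear S -> T})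
  (y : T) : quo_im h := \pi_(quo_im h)%qT y.

Lemma quo_piB (R : pzRingType) (S T : lmodType R) (h : {linear S -> T}) :
  zmod_morphism (quo_pi h).
Proof. exact: (@pi_is_zmod_morphism _ _ _ (Quotient.quot (in_im_zmod h))). Qed.

HB.instance Definition _ (R : pzRingType) (S T : lmodType R)
    (h : {linear S -> T}) :=
  GRing.isZmodMorphism.Build T (quo_im h) (quo_pi h) (quo_piB h).

Lemma quo_pi_eq (R : pzRingType) (S T : lmodType R) (h : {linear S -> T})
  (y z : T) : quo_pi h y = quo_pi h z <-> exists x, h x = y - z.
Proof.
split=> [/eqP|E]; last first.
  by apply/eqP; rewrite /quo_pi -Quotient.idealrBE unfold_in; apply/asboolP.
by rewrite /quo_pi -Quotient.idealrBE unfold_in => /asboolP.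
Qed.

Definition quo_repr (R : pzRingType) (S T : lmodType R) (h : {linear S -> T})
  (q : quo_im h) : T := repr q.

Lemma quo_reprK (R : pzRingType) (S T : lmodType R) (h : {linear S -> T})
  (q : quo_im h) : quo_pi h (quo_repr q) = q.
Proof. exact: reprK. Qed.

Lemma quo_repr_pi (R : pzRingType) (S T : lmodType R) (h : {linear S -> T})
  (y : T) : exists x, h x = quo_repr (quo_pi h y) - y.
Proof. by apply/quo_pi_eq; rewrite quo_reprK. Qed.

Definition quo_scale (R : pzRingType) (S T : lmodType R) (h : {linear S -> T})
  (a : R) (q : quo_im h) : quo_im h := quo_pi h (a *: quo_repr q).

Lemma quo_scale_pi (R : pzRingType) (S T : lmodType R) (h : {linear S -> T})
  (a : R) (y : T) : quo_scale a (quo_pi h y) = quo_pi h (a *: y).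
Proof.
apply/quo_pi_eq; have [x hx] := quo_repr_pi h y.
by exists (a *: x); rewrite linearZ_LR hx scalerBr.
Qed.

Lemma quo_scaleA (R : pzRingType) (S T : lmodType R) (h : {linear S -> T})
  (a b : R) (q : quo_im h) : quo_scale a (quo_scale b q) = quo_scale (a * b) q.
Proof. by rewrite -[q]quo_reprK !quo_scale_pi scalerA. Qed.

Lemma quo_scale1 (R : pzRingType) (S T : lmodType R) (h : {linear S -> T}) :
  left_id 1 (@quo_scale R S T h).
Proof. by move=> q; rewrite -[q]quo_reprK quo_scale_pi scale1r. Qed.

Lemma quo_scaleDr (R : pzRingType) (S T : lmodType R) (h : {linear S -> T}) :
  right_distributive (@quo_scale R S T h) +%R.
Proof.
move=> a q r; rewrite -[q]quo_reprK -[r]quo_reprK -raddfD !quo_scale_pi.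
by rewrite scalerDr raddfD.
Qed.

Lemma quo_scaleDl (R : pzRingType) (S T : lmodType R) (h : {linear S -> T})
    (q : quo_im h) :
  {morph (@quo_scale R S T h)^~ q : a b / a + b}.
Proof.
by move=> a b; rewrite -[q]quo_reprK !quo_scale_pi scalerDl raddfD.
Qed.

HB.instance Definition _ (R : pzRingType) (S T : lmodType R)
    (h : {linear S -> T}) :=
  GRing.Zmodule_isLmodule.Build R (quo_im h) (@quo_scaleA R S T h)
    (@quo_scale1 R S T h) (@quo_scaleDr R S T h) (@quo_scaleDl R S T h).

Lemma quo_piZ (R : pzRingType) (S T : lmodType R) (h : {linear S -> T}) :
  scalable (quo_pi h).
Proof. by move=> a y; rewrite -quo_scale_pi. Qed.

HB.instance Definition _ (R : pzRingType) (S T : lmodType R)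
    (h : {linear S -> T}) :=
  GRing.isScalable.Build R T (quo_im h) *:%R (quo_pi h) (quo_piZ h).

Lemma quo_pi0 (R : pzRingType) (S T : lmodType R) (h : {linear S -> T})
  (x : S) : quo_pi h (h x) = 0.
Proof.
by rewrite -(raddf0 (quo_pi h)); apply/quo_pi_eq; exists x; rewrite subr0.
Qed.

Definition quo_desc_fun (R : pzRingType) (S T : lmodType R)
    (h : {linear S -> T}) (W : lmodType R) (w : {linear T -> W})
    (w0 : forall x, w (h x) = 0) (q : quo_im h) : W :=
  w (quo_repr q).

Lemma quo_desc_pi (R : pzRingType) (S T : lmodType R)
    (h : {linear S -> T}) (W : lmodType R) (w : {linear T -> W})
    (w0 : forall x, w (h x) = 0) (y : T) :
  quo_desc_fun w0 (quo_pi h y) = w y.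
Proof.
have [x hx] := quo_repr_pi h y.
by have := w0 x; rewrite hx raddfB => /eqP; rewrite subr_eq0 => /eqP.
Qed.

Lemma quo_desc_linear (R : pzRingType) (S T : lmodType R)
    (h : {linear S -> T}) (W : lmodType R) (w : {linear T -> W})
    (w0 : forall x, w (h x) = 0) : linear (quo_desc_fun w0).
Proof.
move=> a q r; rewrite -[q]quo_reprK -[r]quo_reprK -linearP !quo_desc_pi.
exact: linearP.
Qed.

HB.instance Definition _ (R : pzRingType) (S T : lmodType R)
    (h : {linear S -> T}) (W : lmodType R) (w : {linear T -> W})
    (w0 : forall x, w (h x) = 0) :=
  GRing.isLinear.Build R (quo_im h) W *:%R (quo_desc_fun w0)
    (quo_desc_linear w0).

Lemma quo_descK (R : pzRingType) (S T : lmodType R) (h : {linear S -> T})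
    (W : lmodType R) (w : {linear T -> W}) (w0 : forall x, w (h x) = 0) :
  lin_comp (quo_desc_fun w0) (quo_pi h) = w.
Proof. by apply: linear_ext => y; exact: quo_desc_pi. Qed.

Lemma quo_uniq (R : pzRingType) (S T : lmodType R) (h : {linear S -> T})
    (W : lmodType R) (v v' : {linear quo_im h -> W}) :
  lin_comp v (quo_pi h) = lin_comp v' (quo_pi h) -> v = v'.
Proof.
move=> E; apply: linear_ext => q; rewrite -[q]quo_reprK.
exact: (congr1 (fun f : {linear T -> W} => f (quo_repr q)) E).
Qed.

Definition std_cokernels (R : pzRingType) : cokernels R := fun S T h =>
  @Cokernel R S T h (quo_im h) (quo_pi h) (@quo_pi0 R S T h)
    (fun W w w0 => quo_desc_fun w0)
    (@quo_descK R S T h) (@quo_uniq R S T h).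

(* Main.v *)
(** The isomorphism [rho] is the second isomorphism theorem: with [f = g ∘ h],
    the cofiber of [Ker f -> Ker g] is [Ker g / (Ker g ∩ Im h)], the fiber of
    [Coker h -> Coker f] is [(Ker g + Im h) / Im h], and [rho] is the map between
    them induced by [Ker g -> T -> Coker h].  It is characterised by a
    factorisation through a monomorphism and an epimorphism, which gives its
    naturality; bijectivity is checked on elements. *)
From HB Require Import structures.
From mathcomp Require Import all_boot all_algebra boolp.
Require Import Defs.

Set Implicit Arguments.
Unset Strict Implicit.
Unset Printing Implicit Defensive.

Import GRing.Theory.
Local Open Scope ring_scope.
Local Open Scope cat_scope.

Section Modules.
Variable R : pzRingType.
Implicit Types S T U W X Y Z : Mod R.

(** * Isomorphisms of modules, checked on elements *)

Lemma hom_ext S T (a b : hom S T) : (forall x, a x = b x) -> a = b.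
Proof. exact: linear_ext. Qed.

Lemma hom_app S T (a b : hom S T) : a = b -> forall x, a x = b x.
Proof. by move=> ->. Qed.

Lemma hom0 S T (a : hom S T) : a 0 = 0.
Proof. exact: raddf0. Qed.

Lemma homB S T (a : hom S T) x y : a (x - y) = a x - a y.
Proof. exact: raddfB. Qed.

(** A set-theoretic section of [a] comes from choice; it is linear and two-sided inverse because [a]
    is injective. *)
Lemma bij_is_iso S T (a : hom S T) :
  (forall x, a x = 0 -> x = 0) -> (forall y, exists x, a x = y) -> is_iso a.
Proof.
move=> a_inj0 a_surj.
have a_inj x y : a x = a y -> x = y.
  move=> axy; apply/eqP; rewrite -subr_eq0; apply/eqP/a_inj0.
  by rewrite homB axy subrr.
have [b bK] := choice a_surj.
have b_lin : linear b.
  by move=> r x y; apply: a_inj; rewrite linearP !bK.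
pose B := GRing.isLinear.Build R T S *:%R b b_lin.
pose b' : {linear T -> S} := HB.pack b B.
exists (b' : hom T S); split; apply: hom_ext => x; last exact: bK.
by apply: a_inj; apply: bK.
Qed.

Lemma iso_inj0 S T (a : hom S T) : is_iso a -> forall x, a x = 0 -> x = 0.
Proof. by case=> b [ba _] x ax0; rewrite -[x](hom_app ba) -(hom0 b) -ax0. Qed.

Lemma iso_surj S T (a : hom S T) : is_iso a -> forall y, exists x, a x = y.
Proof. by case=> b [_ ab] y; exists (b y); exact: (hom_app ab). Qed.

(** * Elements of kernels and cokernels given only by universal properties *)

(** The submodule killed by [ker_in kh] is the test object: its inclusion and the zero map agree
    after [ker_in kh], so they are equal. *)
Lemma ker_in_inj0 S T (h : hom S T) (kh : kernel h) x :
  ker_in kh x = 0 -> x = 0.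
Proof.
move=> x0; pose i := sub_ker_in (ker_in kh).
have /hom_app i0 : @eq (@hom (Mod R) _ _) i \0.
  apply: (ker_uniq kh); apply: hom_ext => y.
  by rewrite /= sub_ker_in0 hom0.
exact: (i0 (SubKer (introT eqP x0))).
Qed.

(** The inclusion of the concrete submodule [sub_ker h] factors through [kh]. *)
Lemma ker_in_exact S T (h : hom S T) (kh : kernel h) s :
  h s = 0 -> exists x, ker_in kh x = s.
Proof.
move=> /eqP s0.
exists (ker_lift kh (@sub_ker_in0 R S T h) (SubKer s0)).
exact: (hom_app (ker_liftK kh (@sub_ker_in0 R S T h)) (SubKer s0)).
Qed.

(** Dually, the projection to the quotient by the image of [coker_pr ch] agrees with zero on that
    image, hence vanishes. *)
Lemma coker_pr_surj S T (h : hom S T) (ch : cokernel h) y :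
  exists x, coker_pr ch x = y.
Proof.
pose p := quo_pi (coker_pr ch).
have /hom_app p0 : @eq (@hom (Mod R) _ _) p \0.
  by apply: (coker_uniq ch); apply: hom_ext => x; exact: quo_pi0.
have /quo_pi_eq[x xy] : p y = p 0 := etrans (p0 y) (esym (raddf0 p)).
by exists x; rewrite xy subr0.
Qed.

Lemma coker_pr_exact S T (h : hom S T) (ch : cokernel h) y :
  coker_pr ch y = 0 -> exists x, h x = y.
Proof.
move=> y0.
have /= := hom_app (coker_descK ch (@quo_pi0 R S T h)) y.
rewrite y0 hom0 -(raddf0 (quo_pi h)) => /esym/quo_pi_eq[x xy].
by exists x; rewrite xy subr0.
Qed.

Variables (k : kernels R) (c : cokernels R).
Let D := ker_coker k c.

(** * Rules for the structure maps of [D] *)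

Lemma fibME S T Z (h : hom S T) (g : hom T Z) (f : hom S Z) (E : g ∘ h = f) :
  fib_in D g ∘ fibM D E = h ∘ fib_in D f.
Proof. exact: ker_liftK. Qed.

Lemma cofME S T Z (h : hom S T) (g : hom T Z) (f : hom S Z) (E : g ∘ h = f) :
  cofM D E ∘ cof_pr D h = cof_pr D f ∘ g.
Proof. exact: coker_descK. Qed.

Lemma fib_uniq S T (h : hom S T) W (v v' : hom W (fib D h)) :
  fib_in D h ∘ v = fib_in D h ∘ v' -> v = v'.
Proof. exact: ker_uniq. Qed.

Lemma cof_uniq S T (h : hom S T) W (v v' : hom (cof D h) W) :
  v ∘ cof_pr D h = v' ∘ cof_pr D h -> v = v'.
Proof. exact: coker_uniq. Qed.

Lemma fib_in0 S T (h : hom S T) x : h (fib_in D h x) = 0.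
Proof. exact: ker_in0. Qed.

Lemma cof_pr0 S T (h : hom S T) x : cof_pr D h (h x) = 0.
Proof. exact: coker_pr0. Qed.

Lemma fib_in_inj0 S T (h : hom S T) x : fib_in D h x = 0 -> x = 0.
Proof. exact: ker_in_inj0. Qed.

Lemma fib_in_inj S T (h : hom S T) x y : fib_in D h x = fib_in D h y -> x = y.
Proof.
move=> xy; apply/eqP; rewrite -subr_eq0; apply/eqP/(@fib_in_inj0 _ _ h).
by rewrite homB xy subrr.
Qed.

Lemma fib_in_exact S T (h : hom S T) s :
  h s = 0 -> exists x, fib_in D h x = s.
Proof. exact: ker_in_exact. Qed.

Lemma cof_pr_surj S T (h : hom S T) y : exists x, cof_pr D h x = y.
Proof. exact: coker_pr_surj. Qed.

Lemma cof_pr_exact S T (h : hom S T) y :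
  cof_pr D h y = 0 -> exists x, h x = y.
Proof. exact: coker_pr_exact. Qed.

Lemma fibM_app S T Z (h : hom S T) (g : hom T Z) (f : hom S Z)
    (E : g ∘ h = f) x :
  fib_in D g (fibM D E x) = h (fib_in D f x).
Proof. exact: (hom_app (fibME E)). Qed.

Lemma cofM_app S T Z (h : hom S T) (g : hom T Z) (f : hom S Z)
    (E : g ∘ h = f) x :
  cofM D E (cof_pr D h x) = cof_pr D f (g x).
Proof. exact: (hom_app (cofME E)). Qed.

(** * Canonical isomorphisms and the comparison map [rho] *)

Section CanonicalIsos.
Variables (S T Z : Mod R) (h : hom S T) (g : hom T Z) (f : hom S Z).
Hypothesis E : g ∘ h = f.

(** Since [f] factors through [h], Ker h lies in Ker f, so restricting [h] to Ker f leaves its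
    kernel unchanged. *)
Lemma ker_coker_fib_of_fibM :
  exists th : hom (fib D (fibM D E)) (fib D h),
    is_iso th /\ fib_in D h ∘ th = fib_in D f ∘ fib_in D (fibM D E).
Proof.
have w0 x : h ((fib_in D f ∘ fib_in D (fibM D E)) x) = 0.
  by rewrite /= -(fibM_app E) fib_in0 hom0.
pose th : hom (fib D (fibM D E)) (fib D h) := ker_lift (k h) w0.
have thE : fib_in D h ∘ th = fib_in D f ∘ fib_in D (fibM D E).
  exact: ker_liftK.
exists th; split=> //; apply: bij_is_iso => [x x0|y].
  apply/(@fib_in_inj0 _ _ (fibM D E))/(@fib_in_inj0 _ _ f).
  by rewrite -[LHS](hom_app thE) /= x0 hom0.
have [x xy] : exists x, fib_in D f x = fib_in D h y.
  by apply: fib_in_exact; rewrite -E /= fib_in0 hom0.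
have [z zx] : exists z, fib_in D (fibM D E) z = x.
  apply: fib_in_exact; apply: (@fib_in_inj0 _ _ g).
  by rewrite fibM_app xy fib_in0.
exists z; apply: (@fib_in_inj _ _ h).
by rewrite -xy -zx; exact: (hom_app thE).
Qed.

(** Third isomorphism theorem: (Z / Im f) / (Im g / Im f) is Z / Im g. *)
Lemma ker_coker_cof_of_cofM :
  exists th : hom (cof D g) (cof D (cofM D E)),
    is_iso th /\ th ∘ cof_pr D g = cof_pr D (cofM D E) ∘ cof_pr D f.
Proof.
have w0 x : (cof_pr D (cofM D E) ∘ cof_pr D f) (g x) = 0.
  by rewrite /= -(cofM_app E) cof_pr0.
pose th : hom (cof D g) (cof D (cofM D E)) := coker_desc (c g) w0.
have thE : th ∘ cof_pr D g = cof_pr D (cofM D E) ∘ cof_pr D f.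
  exact: coker_descK.
exists th; split=> //; apply: bij_is_iso => [x|y].
  have [z <-] := cof_pr_surj x.
  move/(etrans (esym (hom_app thE z)))/cof_pr_exact=> [d].
  have [t <-] := cof_pr_surj d.
  rewrite cofM_app => /eqP; rewrite -subr_eq0 -homB => /eqP/cof_pr_exact[s].
  rewrite -E /= => hs.
  (* Here [z = g (t - h s)], so its class modulo Im g is zero. *)
  by rewrite -[z](subKr (g t)) -hs -homB cof_pr0.
have [d <-] := cof_pr_surj y; have [z <-] := cof_pr_surj d.
by exists (cof_pr D g z); exact: (hom_app thE).
Qed.

Lemma rho_lift_subproof x :
  cofM D E ((cof_pr D h ∘ fib_in D g) x) = 0.
Proof. by rewrite /= cofM_app fib_in0 hom0. Qed.

Lemma rho_desc_subproof x :
  ker_lift (k (cofM D E)) rho_lift_subproof (fibM D E x) = 0.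
Proof.
apply: (@fib_in_inj0 _ _ (cofM D E)).
rewrite -[LHS]/((_ ∘ ker_lift _ _) _) (hom_app (ker_liftK _ _)) /=.
by rewrite -/D fibM_app cof_pr0.
Qed.

Definition rho : hom (cof D (fibM D E)) (fib D (cofM D E)) :=
  coker_desc (c (fibM D E)) rho_desc_subproof.

(** This equation determines [rho], the outer maps being mono and epi; everything later about [rho]
    rests on it. *)
Lemma rhoE :
  fib_in D (cofM D E) ∘ rho ∘ cof_pr D (fibM D E) = cof_pr D h ∘ fib_in D g.
Proof.
by rewrite -ccompA [rho ∘ _]coker_descK; exact: ker_liftK.
Qed.

Lemma rho_app x :
  fib_in D (cofM D E) (rho (cof_pr D (fibM D E) x))
  = cof_pr D h (fib_in D g x).
Proof. exact: (hom_app rhoE). Qed.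

Lemma rho_iso : is_iso rho.
Proof.
apply: bij_is_iso => [x|y].
  have [z <-] := cof_pr_surj x => /(congr1 (fib_in D (cofM D E))).
  rewrite rho_app hom0 => /cof_pr_exact[s hs].
  have [v vs] : exists v, fib_in D f v = s.
    by apply: fib_in_exact; rewrite -E /= hs fib_in0.
  suff -> : z = fibM D E v by rewrite cof_pr0.
  by apply: (@fib_in_inj _ _ g); rewrite fibM_app vs hs.
have [t ty] := cof_pr_surj (fib_in D (cofM D E) y).
have [s fs] : exists s, f s = g t.
  by apply: cof_pr_exact; rewrite -(cofM_app E) ty fib_in0.
(* The representative [t] is corrected by [h s]: this keeps its class in Coker h and moves it into
   Ker g. *)
have [z zt] : exists z, fib_in D g z = t - h s.
  by apply: fib_in_exact; rewrite homB -fs -E /= subrr.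
exists (cof_pr D (fibM D E) z); apply: (@fib_in_inj _ _ (cofM D E)).
by rewrite rho_app zt homB cof_pr0 subr0.
Qed.

End CanonicalIsos.

(** * Functoriality, and naturality of [rho] *)

Lemma ker_coker_axioms : fcAxioms D.
Proof.
split.
- by move=> S Z f E; apply: fib_uniq; rewrite fibME ccomp1m ccompm1.
- move=> S T U Z f g l h u v E1 E2 E3 uh; apply: fib_uniq.
  by rewrite ccompA !fibME -ccompA fibME ccompA uh.
- by move=> S T h E; apply: cof_uniq; rewrite cofME ccomp1m ccompm1.
- move=> S T U Z h l f u g v E1 E2 E3 gu; apply: cof_uniq.
  by rewrite -ccompA !cofME ccompA cofME -ccompA gu.
- exact: ker_coker_fib_of_fibM.
- exact: ker_coker_cof_of_cofM.
Qed.

Lemma ker_coker_bicharadic1 : bicharadic1 ker_coker_axioms.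
Proof.
exists (fun S T Z h g f E => rho E); split; first exact: rho_iso.
move=> S T' T'' Z f h' g' h'' g'' u E' E'' Eh Eg.
(* Once the mono and the epi are attached, both sides equal [cof_pr D h'' ∘ u ∘ fib_in D g']. *)
apply: fib_uniq; apply: cof_uniq.
by rewrite -!ccompA cofME !ccompA rhoE fibME -!ccompA fibME
  [in RHS](ccompA (fib_in _ _)) rhoE !ccompA cofME.
Qed.

(** * Maps induced by squares with invertible sides *)

Section Squares.
Variables (S' T' S'' T'' : Mod R) (h' : hom S' T') (h'' : hom S'' T'').
Variables (s : hom S' S'') (t : hom T' T'').
Hypothesis q : isoSquare h' h'' s t.

Lemma square_app x : t (h' x) = h'' (s x).
Proof. exact: (hom_app (isq_comm q)). Qed.

Lemma sfib_subproof x : h'' ((s ∘ fib_in D h') x) = 0.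
Proof. by rewrite /= -square_app fib_in0 hom0. Qed.

Lemma tcof_subproof x : (cof_pr D h'' ∘ t) (h' x) = 0.
Proof. by rewrite /= square_app cof_pr0. Qed.

Definition sfib : hom (fib D h') (fib D h'') := ker_lift (k h'') sfib_subproof.

Definition tcof : hom (cof D h') (cof D h'') := coker_desc (c h') tcof_subproof.

Lemma sfibE : fib_in D h'' ∘ sfib = s ∘ fib_in D h'.
Proof. exact: ker_liftK. Qed.

Lemma tcofE : tcof ∘ cof_pr D h' = cof_pr D h'' ∘ t.
Proof. exact: coker_descK. Qed.

Lemma sfib_iso : is_iso sfib.
Proof.
apply: bij_is_iso => [x x0|y].
  apply/(@fib_in_inj0 _ _ h')/(iso_inj0 (isq_s q)).
  by rewrite -[LHS](hom_app sfibE) /= x0 hom0.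
have [z zy] := iso_surj (isq_s q) (fib_in D h'' y).
(* Injectivity of [t] puts the preimage [z] in Ker h'. *)
have [x xz] : exists x, fib_in D h' x = z.
  apply: fib_in_exact; apply: (iso_inj0 (isq_t q)).
  by rewrite square_app zy fib_in0.
exists x; apply: (@fib_in_inj _ _ h'').
by rewrite -zy -xz; exact: (hom_app sfibE).
Qed.

Lemma tcof_iso : is_iso tcof.
Proof.
apply: bij_is_iso => [x|y].
  have [z <-] := cof_pr_surj x.
  move/(etrans (esym (hom_app tcofE z)))/cof_pr_exact=> [y].
  (* Surjectivity of [s] pulls [y] back to S', so that [t] can be cancelled. *)
  have [w <-] := iso_surj (isq_s q) y.
  rewrite -square_app => /eqP; rewrite -subr_eq0 -homB => /eqP.
  move/(iso_inj0 (isq_t q))/eqP; rewrite subr_eq0 => /eqP <-.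
  exact: cof_pr0.
have [z <-] := cof_pr_surj y; have [w <-] := iso_surj (isq_t q) z.
by exists (cof_pr D h' w); exact: (hom_app tcofE).
Qed.

End Squares.

(** All the equations follow by uniqueness: the two sides agree after the kernel inclusion, or
    before the cokernel projection. *)
Lemma ker_coker_bicharadic2 : bicharadic2 D.
Proof.
exists sfib, tcof; split.
- by move=> *; split; [exact: sfib_iso | exact: tcof_iso].
- move=> S T h q; split.
    by apply: fib_uniq; rewrite sfibE ccomp1m ccompm1.
  by apply: cof_uniq; rewrite tcofE ccomp1m ccompm1.
- move=> S1 T1 S2 T2 S3 T3 h1 h2 h3 s t s' t' q q' r; split.
    by apply: fib_uniq; rewrite ccompA !sfibE -ccompA sfibE ccompA.
  by apply: cof_uniq; rewrite -ccompA !tcofE ccompA tcofE -ccompA.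
- by move=> S' S'' T h' h'' s q E; apply: fib_uniq; rewrite sfibE fibME.
- by move=> S T' T'' h' h'' t q E; apply: cof_uniq; rewrite tcofE cofME.
Qed.

End Modules.

Theorem proposition26 (R : pzRingType) (k : kernels R) (c : cokernels R) :
  bicharadic (ker_coker k c).
Proof.
exact: Bicharadic (ker_coker_bicharadic1 k c) (ker_coker_bicharadic2 k c).
Qed.
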